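(* If the uncertainty set $\Xi\subset\mathbb{R}^N$ is a simplex (with non-empty interior), then the affinely adjustable robust counterpart AARC and the fully adjustable robust counterpart FARC have equal optimal values.
   Context: Setting: $m,n,q\ge 1$ are integers, $V\in\mathbb{R}^{m\times q}$ and $c\in\mathbb{R}^n$ are fixed. An uncertain parameter is $\xi\equiv[U_\xi,b_\xi]$ with $U_\xi\in\mathbb{R}^{m\times n}$, $b_\xi\in\mathbb{R}^m$, identified with a vector of $\mathbb{R}^N$, $N=m(n+1)$. Throughout, the uncertainty set $\Xi\subset\mathbb{R}^N$ is compact, convex, with non-empty interior. Vector inequalities are componentwise. FARC: minimize $c^Tu$ over $u\in\mathbb{R}^n$ and arbitrary functions $v:\Xi\to\mathbb{R}^q$ subject to $U_\xi u+Vv(\xi)\le b_\xi$ for all $\xi\in\Xi$. AARC: the same problem with $v$ restricted to affine functions $v(\xi)=w+W\xi$, $w\in\mathbb{R}^q$, $W\in\mathbb{R}^{q\times N}$. Optimal values are infima in $[-\infty,+\infty]$. *)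

(* Defs.v *)
From HB Require Import structures.
From mathcomp Require Import all_boot all_order all_algebra.
From mathcomp Require Import all_classical all_reals all_analysis.

Set Implicit Arguments.
Unset Strict Implicit.
Unset Printing Implicit Defensive.

Import Order.TTheory GRing.Theory Num.Theory.
Import numFieldNormedType.Exports.

Local Open Scope classical_set_scope.
Local Open Scope ring_scope.

Section Simplex.
Variables (R : realType) (N : nat).

Definition convex_hull (k : nat) (p : 'I_k -> 'cV[R]_N) : set 'cV[R]_N :=
  [set x | exists l : 'I_k -> R,
     [/\ forall i, 0 <= l i, \sum_(i < k) l i = 1
       & x = \sum_(i < k) l i *: p i]].

Definition affinely_independent (k : nat) (p : 'I_k.+1 -> 'cV[R]_N) : Prop :=
  free [tuple p (lift ord0 i) - p ord0 | i < k].

(* The dimension k is not required to be N: a full-dimensional simplex is a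
   simplex with non-empty interior. *)
Definition simplex (S : set 'cV[R]_N) : Prop :=
  exists (k : nat) (p : 'I_k.+1 -> 'cV[R]_N),
    affinely_independent p /\ S = convex_hull p.

Definition uncertainty_set (Xi : set 'cV[R]_N) : Prop :=
  [/\ compact Xi, convex_set Xi & Xi° !=set0].

End Simplex.

Section RobustCounterparts.
Variables (R : realType) (m n q : nat).

Definition cvle (k : nat) (x y : 'cV[R]_k) : Prop :=
  forall i, x i ord0 <= y i ord0.

(* The m x (n + 1) matrix [U, b] is identified with the vector of R^(m(n+1))
   listing its entries row by row. *)
Definition unc_U (xi : 'cV[R]_(m * (n + 1))) : 'M[R]_(m, n) :=
  lsubmx (vec_mx xi^T).

Definition unc_b (xi : 'cV[R]_(m * (n + 1))) : 'cV[R]_m :=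
  rsubmx (vec_mx xi^T).

(* A function on the uncertainty set is encoded as a total function on
   R^(m(n+1)), whose values off the uncertainty set are never used. *)
Definition policy := 'cV[R]_(m * (n + 1)) -> 'cV[R]_q.

Definition affine_policy : set policy :=
  [set v | exists (w : 'cV[R]_q) (W : 'M[R]_(q, m * (n + 1))),
     forall xi, v xi = w + W *m xi].

Definition robust_feasible (V : 'M[R]_(m, q)) (Xi : set 'cV[R]_(m * (n + 1)))
    (u : 'cV[R]_n) (v : policy) : Prop :=
  forall xi, Xi xi -> cvle (unc_U xi *m u + V *m v xi) (unc_b xi).

Definition robust_value (P : set policy) (V : 'M[R]_(m, q)) (c : 'cV[R]_n)
    (Xi : set 'cV[R]_(m * (n + 1))) : \bar R :=
  ereal_inf [set z | exists (u : 'cV[R]_n) (v : policy),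
    [/\ P v, robust_feasible V Xi u v
      & z = ((c^T *m u) ord0 ord0)%:E]].

Definition FARC_value := robust_value setT.

Definition AARC_value := robust_value affine_policy.

End RobustCounterparts.

(* Main.v *)
(** Fix [u] and interpolate a feasible policy affinely at the vertices of the
    simplex, which affine independence permits. The robust constraint is linear
    in the pair [(xi, v xi)], so it passes from the vertices to their convex
    combinations. *)
Require Import Defs.
From HB Require Import structures.
From mathcomp Require Import all_boot all_order all_algebra.
From mathcomp Require Import all_classical all_reals all_analysis.

Local Open Scope classical_set_scope.
Local Open Scope ring_scope.

Import GRing.Theory Num.Theory.

Lemma linear_cV_mulmx (R : comNzRingType) (n m : nat)
    (f : {linear 'cV[R]_n -> 'cV[R]_m}) :
  exists W : 'M[R]_(m, n), forall x, W *m x = f x.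
Proof.
exists (\matrix_(i, j) f (delta_mx j 0) i 0) => x.
rewrite [in RHS](matrix_sum_delta x) linear_sum; apply/colP => i.
rewrite mxE summxE; apply: eq_bigr => j _.
by rewrite big_ord1 linearZ /= !mxE mulrC.
Qed.

(** The maps [coord X i] are linear forms on the whole space and, for free [X], dual to the vectors
    of [X]; weighting each [z i] by its form gives the required linear map. *)
Lemma free_interpolation (R : fieldType) (n m k : nat)
    (X : k.-tuple 'cV[R]_n) (z : 'I_k -> 'cV[R]_m) :
  free X -> exists W : 'M[R]_(m, n), forall i : 'I_k, W *m X`_i = z i.
Proof.
move=> freeX.
pose f (x : 'cV[R]_n) := \sum_(i < k) coord X i x *: z i.
have f_lin : linear f.
  move=> a x y; rewrite /f scaler_sumr -big_split; apply: eq_bigr => i _ /=.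
  by rewrite linearP scalerDl scalerA.
pose fL := GRing.isLinear.Build R 'cV[R]_n 'cV[R]_m *:%R f f_lin.
pose F : {linear 'cV[R]_n -> 'cV[R]_m} := HB.pack f fL.
have [W WE] := linear_cV_mulmx _ _ _ F.
exists W => i; rewrite WE /= /f (bigD1 i) //= coord_free // eqxx scale1r.
rewrite big1 ?addr0 // => j ji.
by rewrite coord_free // eq_sym (negbTE ji) scale0r.
Qed.

(** Linear interpolation on the free differences [p (lift ord0 i) - p ord0] fixes [W]; then [w] is
    forced by the value at [p ord0]. *)
Lemma affine_interpolation (R : realType) (N q k : nat)
    (p : 'I_k.+1 -> 'cV[R]_N) (y : 'I_k.+1 -> 'cV[R]_q) :
  affinely_independent p ->
  exists (w : 'cV[R]_q) (W : 'M[R]_(q, N)), forall i, w + W *m p i = y i.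
Proof.
move=> /(@free_interpolation _ _ _ _ _ (fun i => y (lift ord0 i) - y ord0)).
move=> [W WE]; exists (y ord0 - W *m p ord0), W => i.
case: (unliftP ord0 i) => [j|] ->; last by rewrite subrK.
have := WE j; rewrite -tnth_nth tnth_mktuple mulmxBr => WEj.
by rewrite -addrA [- _ + _]addrC WEj addrC subrK.
Qed.

Section Slack.
Variables (R : realType) (m n q : nat) (V : 'M[R]_(m, q)) (u : 'cV[R]_n).

(** The recourse value [y] is an argument independent of [xi], so that for fixed [u] the slack is
    jointly linear in the pair. *)
Definition slack (xi : 'cV[R]_(m * (n + 1))) (y : 'cV[R]_q) : 'cV[R]_m :=
  unc_b xi - (unc_U xi *m u + V *m y).

Lemma cvle_slack xi y :
  cvle (unc_U xi *m u + V *m y) (unc_b xi) <->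
  forall i, 0 <= slack xi y i ord0.
Proof.
rewrite /slack; move: (unc_b xi) (_ + _) => b a.
by split=> h i; have := h i; rewrite !mxE subr_ge0.
Qed.

(** No condition on the weights is needed: [unc_U] and [unc_b] are linear in [xi], so the slack has
    no constant term. *)
Lemma slack_sum k (l : 'I_k -> R) xi y :
  slack (\sum_(i < k) l i *: xi i) (\sum_(i < k) l i *: y i) =
  \sum_(i < k) l i *: slack (xi i) (y i).
Proof.
rewrite /slack /unc_b /unc_U !linear_sum mulmx_suml.
rewrite -big_split -sumrB; apply: eq_bigr => i _ /=.
by rewrite !linearZ /= -scalemxAl -scalerDr -scalerBr.
Qed.

End Slack.

(** Keeping the same [u] preserves the objective value. The policies [v] and [v'] need to agree only
    at the vertices. *)
Lemma robust_feasible_affine (R : realType) (m n q : nat)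
    (V : 'M[R]_(m, q)) (Xi : set 'cV[R]_(m * (n + 1)))
    (u : 'cV[R]_n) (v : policy R m n q) :
  simplex Xi -> robust_feasible V Xi u v ->
  exists2 v' : policy R m n q, affine_policy v' & robust_feasible V Xi u v'.
Proof.
move=> [k [p [p_free ->]]] v_feas.
have [w [W WE]] := affine_interpolation _ _ _ _ _ (fun i => v (p i)) p_free.
exists (fun xi => w + W *m xi); first by exists w, W.
(* Feasibility of [v] is known on the hull only, so the vertices must be placed in it, with
   Kronecker delta weights. *)
have p_hull i : convex_hull p (p i).
  exists (fun j => (j == i)%:R); split=> [j||]; first exact: ler0n.
  - by rewrite (bigD1 i) //= eqxx big1 ?addr0 // => j /negbTE ->.
  - rewrite (bigD1 i) //= eqxx scale1r big1 ?addr0 // => j /negbTE ->.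
    by rewrite scale0r.
move=> _ [l [l_ge0 l_sum ->]]; apply/cvle_slack => a.
(* Since the weights sum to 1, the constant [w] can be distributed over the vertices. *)
have -> : w + W *m (\sum_(i < k.+1) l i *: p i) =
          \sum_(i < k.+1) l i *: v (p i).
  rewrite -[w in LHS]scale1r -l_sum scaler_suml mulmx_sumr -big_split /=.
  by apply: eq_bigr => i _; rewrite -scalemxAr -scalerDr WE.
rewrite slack_sum summxE; apply: sumr_ge0 => i _.
rewrite mxE mulr_ge0 //; move: a; apply/cvle_slack; exact: v_feas.
Qed.

Theorem corollary2 (R : realType) (m n q : nat)
    (m_ge1 : (1 <= m)%N) (n_ge1 : (1 <= n)%N) (q_ge1 : (1 <= q)%N)
    (V : 'M[R]_(m, q)) (c : 'cV[R]_n) (Xi : set 'cV[R]_(m * (n + 1)))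
    (Xi_unc : uncertainty_set Xi) (Xi_simplex : simplex Xi) :
  AARC_value V c Xi = FARC_value V c Xi.
Proof.
rewrite /AARC_value /FARC_value /robust_value; congr (ereal_inf _).
(* The two sets of attainable objective values coincide, which also settles infinite optimal
   values. *)
apply/seteqP; split=> z [u [v [v_pol v_feas ->]]]; first by exists u, v.
have [v' v'_aff v'_feas] := robust_feasible_affine _ _ _ _ _ _ _ _ Xi_simplex v_feas.
by exists u, v'.
Qed.
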